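(* Let $k$ be a field of characteristic zero, and let $k[[x]][x^{-1}]$ be the localization of the formal power series algebra $k[[x]]=k[[x_1,\dots,x_n]]$ in the elements $x_1,\dots,x_n$. Then $k[[x]][x^{-1}]$ has no nonzero locally finite $k$-derivations.
   Context: A $k$-derivation of a commutative $k$-algebra $\mathcal{A}$ is a $k$-linear map $D:\mathcal{A}\to\mathcal{A}$ with $D(ab)=D(a)b+aD(b)$ for all $a,b\in\mathcal{A}$. It is locally finite if for each $a\in\mathcal{A}$ the $k$-subspace spanned by the elements $D^m(a)$ ($m\ge 0$) is finite dimensional over $k$. *)

(* Defs.v *)
From HB Require Import structures.
From mathcomp Require Import all_boot all_algebra generic_quotient.
From mathcomp Require Import boolp.
From mathcomp Require Import mpoly.
From mathcomp Require Import ring.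

Set Implicit Arguments.
Unset Strict Implicit.
Unset Printing Implicit Defensive.

Import GRing.Theory.
Local Open Scope ring_scope.
Local Open Scope quotient_scope.

(* k[[x_1, ..., x_n]]: a formal power series is its family of coefficients,
   indexed by the exponent vectors 'X_{1..n}. *)
Record mpseries (n : nat) (R : Type) := MPSeries { pscoef : 'X_{1..n} -> R }.

HB.instance Definition _ (n : nat) (R : Type) := [isNew for @pscoef n R].
HB.instance Definition _ (n : nat) (R : choiceType) :=
  [Choice of mpseries n R by <:].

Section PowerSeries.
Variables (n : nat) (R : comNzRingType).
Implicit Types (f g h : mpseries n R) (m : 'X_{1..n}).

Lemma psP f g : pscoef f =1 pscoef g <-> f = g.
Proof.
split=> [eq_fg|->//]; case: f g eq_fg => [f] [g] /= eq_fg.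
by congr MPSeries; apply/funext.
Qed.

Definition psadd f g := MPSeries (fun m => pscoef f m + pscoef g m).
Definition psopp f := MPSeries (fun m => - pscoef f m).
Definition psC (c : R) : mpseries n R :=
  MPSeries (fun m => if m == 0%MM then c else 0).

(* Cauchy product; two monomials with product m both have degree < |m| + 1,
   so the bound on the finite index type excludes no pair. *)
Definition psmul f g := MPSeries (fun m =>
  \sum_(p : 'X_{1..n < (mdeg m).+1, (mdeg m).+1} | m == (p.1 + p.2)%MM)
     pscoef f p.1 * pscoef g p.2).

Definition psscale (c : R) f := MPSeries (fun m => c * pscoef f m).

Lemma psaddA : associative psadd.
Proof. by move=> f g h; apply/psP => m /=; rewrite addrA. Qed.

Lemma psaddC : commutative psadd.
Proof. by move=> f g; apply/psP => m /=; rewrite addrC. Qed.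

Lemma psadd0 : left_id (psC 0) psadd.
Proof. by move=> f; apply/psP => m /=; rewrite if_same add0r. Qed.

Lemma psaddN : left_inverse (psC 0) psopp psadd.
Proof. by move=> f; apply/psP => m /=; rewrite if_same addNr. Qed.

HB.instance Definition _ :=
  GRing.isZmodule.Build (mpseries n R) psaddA psaddC psadd0 psaddN.

(* The ring axioms are transported from {mpoly R[n]} by truncation. *)
Let trunc d f : {mpoly R[n]} :=
  \sum_(m : 'X_{1..n < d}) (pscoef f m *: 'X_[m]).

Let truncE d f m : (mdeg m < d)%N -> (trunc d f)@_m = pscoef f m.
Proof. by move=> lt_md; rewrite mcoeff_mpoly. Qed.

Let mdeg_leD m a b :
  m = (a + b)%MM -> (mdeg a <= mdeg m)%N /\ (mdeg b <= mdeg m)%N.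
Proof. by move=> ->; rewrite mdegD leq_addr leq_addl. Qed.

Let truncM_eq d (p p' q q' : {mpoly R[n]}) m : (mdeg m < d)%N ->
    (forall m', (mdeg m' < d)%N -> p@_m' = p'@_m') ->
    (forall m', (mdeg m' < d)%N -> q@_m' = q'@_m') ->
  (p * q)@_m = (p' * q')@_m.
Proof.
move=> lt_md eq_p eq_q; rewrite !mcoeffM; apply: eq_bigr => -[a b] /= /eqP eq_m.
have [le_a le_b] := mdeg_leD eq_m.
by rewrite eq_p ?eq_q // (leq_ltn_trans _ lt_md).
Qed.

Let psmulE d f g m : (mdeg m < d)%N ->
  pscoef (psmul f g) m = (trunc d f * trunc d g)@_m.
Proof.
move=> lt_md; rewrite mcoeffM; apply: eq_bigr => -[a b] /= /eqP eq_m.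
have [le_a le_b] := mdeg_leD eq_m.
by rewrite !truncE // (leq_ltn_trans _ lt_md).
Qed.

Lemma psmulA : associative psmul.
Proof.
move=> f g h; apply/psP => m; rewrite !(psmulE _ _ (ltnSn (mdeg m))).
set d := (mdeg m).+1.
transitivity ((trunc d f * (trunc d g * trunc d h))@_m).
  apply: (@truncM_eq d) => // m' lt_m'd.
  by rewrite truncE // (psmulE _ _ lt_m'd).
rewrite mulrA; apply: (@truncM_eq d) => // m' lt_m'd.
by rewrite truncE // (psmulE _ _ lt_m'd).
Qed.

Lemma psmulC : commutative psmul.
Proof.
by move=> f g; apply/psP => m; rewrite !(psmulE _ _ (ltnSn (mdeg m))) mulrC.
Qed.

Lemma pscoefCM c f m : pscoef (psmul (psC c) f) m = c * pscoef f m.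
Proof.
rewrite (psmulE _ _ (ltnSn (mdeg m))) -(truncE _ (ltnSn (mdeg m))) -mcoeffCM.
apply: (@truncM_eq (mdeg m).+1) => // m' lt_m'.
by rewrite truncE // mcoeffC /=; case: eqP; rewrite ?mulr1 ?mulr0.
Qed.

Lemma psmul1 : left_id (psC 1) psmul.
Proof. by move=> f; apply/psP => m; rewrite pscoefCM mul1r. Qed.

Lemma psmulD : left_distributive psmul psadd.
Proof.
move=> f g h; apply/psP => m /=; rewrite -big_split /=.
by apply: eq_bigr => p _; rewrite mulrDl.
Qed.

Lemma ps1_neq0 : psC 1 != psC 0.
Proof.
apply/eqP => /psP/(_ 0%MM) /=; rewrite eqxx.
by apply/eqP/oner_neq0.
Qed.

HB.instance Definition _ := GRing.Zmodule_isComNzRing.Build (mpseries n R)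
  psmulA psmulC psmul1 psmulD ps1_neq0.

Lemma psscaleA c c' f : psscale c (psscale c' f) = psscale (c * c') f.
Proof. by apply/psP => m /=; rewrite mulrA. Qed.

Lemma psscale1 : left_id 1 psscale.
Proof. by move=> f; apply/psP => m /=; rewrite mul1r. Qed.

Lemma psscaleDr : right_distributive psscale +%R.
Proof. by move=> c f g; apply/psP => m /=; rewrite mulrDr. Qed.

Lemma psscaleDl f : {morph psscale^~ f : c c' / c + c'}.
Proof. by move=> c c'; apply/psP => m /=; rewrite mulrDl. Qed.

HB.instance Definition _ := GRing.Zmodule_isLmodule.Build R (mpseries n R)
  psscaleA psscale1 psscaleDr psscaleDl.

Lemma psscaleAl c f g : c *: (f * g) = (c *: f) * g.
Proof.
apply/psP => m /=; rewrite mulr_sumr.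
by apply: eq_bigr => p _; rewrite mulrA.
Qed.

HB.instance Definition _ :=
  GRing.Lmodule_isLalgebra.Build R (mpseries n R) psscaleAl.
HB.instance Definition _ := GRing.Lalgebra_isComAlgebra.Build R (mpseries n R).

Definition psX (i : 'I_n) : mpseries n R :=
  MPSeries (fun m => if m == U_(i)%MM then 1 else 0).

(* The multiplicative set generated by the variables x_1, ..., x_n. *)
Definition psmonomial : {pred mpseries n R} := fun f =>
  `[< exists m : 'X_{1..n}, f = \prod_(i < n) psX i ^+ m i >].

Lemma psmonomial_mulr_closed : mulr_closed psmonomial.
Proof.
split=> [|f g /asboolP[m1 ->] /asboolP[m2 ->]]; apply/asboolP.
  by exists 0%MM; rewrite big1 // => i _; rewrite mnm0E expr0.
exists (m1 + m2)%MM; rewrite -big_split /=.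
by apply: eq_bigr => i _; rewrite mnmDE exprD.
Qed.

HB.instance Definition _ :=
  GRing.isMulClosed.Build (mpseries n R) psmonomial psmonomial_mulr_closed.

Lemma pscoef_monomial (m m' : 'X_{1..n}) :
  pscoef (\prod_(i < n) psX i ^+ m i) m' = if m' == m then 1 else 0.
Proof.
have coefM (f g : mpseries n R) (p q : {mpoly R[n]}) :
    pscoef f =1 (fun m => p@_m) -> pscoef g =1 (fun m => q@_m) ->
  pscoef (f * g) =1 (fun m => (p * q)@_m).
  move=> eq_f eq_g m1; rewrite mcoeffM; apply: eq_bigr => p' _.
  by rewrite eq_f eq_g.
have coef1 : pscoef (1 : mpseries n R) =1 (fun m => (1 : {mpoly R[n]})@_m).
  by move=> m1; rewrite mcoeff1 /=; case: eqP.
have coefX i : pscoef (psX i) =1 (fun m => ('X_i : {mpoly R[n]})@_m).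
  by move=> m1; rewrite mcoeffX eq_sym /=; case: eqP.
suff -> : pscoef (\prod_(i < n) psX i ^+ m i) m'
    = (\prod_(i < n) 'X_i ^+ m i : {mpoly R[n]})@_m'.
  by rewrite -mpolyXE_id mcoeffX eq_sym; case: eqP.
move: m'; elim/big_ind2: _ => // [f p g q|i _]; first exact: coefM.
by elim: (m i) => // e IHe; rewrite !exprS; apply: coefM.
Qed.

Lemma psmonomial_neq0 f : f \in psmonomial -> f != 0.
Proof.
move=> /asboolP[m ->]; apply/eqP => /psP/(_ m).
by rewrite pscoef_monomial eqxx /= if_same; apply/eqP/oner_neq0.
Qed.

End PowerSeries.

Section Localization.
Variables (R : comPzRingType) (S : mulrClosed R).

Record locfrac := LocFrac { locpair :> R * R; locfracP : locpair.2 \in S }.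

HB.instance Definition _ := [isSub for locpair].
HB.instance Definition _ := [Choice of locfrac by <:].

Implicit Types x y z : locfrac.

Definition loceq x y : bool :=
  `[< exists2 t, t \in S & t * (x.1 * y.2) = t * (y.1 * x.2) >].

Lemma loceq_refl : reflexive loceq.
Proof. by move=> x; apply/asboolP; exists 1; rewrite ?rpred1. Qed.

Lemma loceq_sym : ssrbool.symmetric loceq.
Proof.
by move=> x y; apply/asboolP/asboolP => -[t St eq_t]; exists t; rewrite ?eq_t.
Qed.

Lemma loceq_trans : transitive loceq.
Proof.
move=> [[b u] /= Su] [[a s] /= Ss] [[c v] /= Sv].
move=> /asboolP[t St /= eq_ab] /asboolP[t' St' /= eq_bc].
apply/asboolP; exists (t * t' * u); first by rewrite !rpredM.
rewrite /=; transitivity (t' * v * (t * (a * u))).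
  by rewrite (AC (3*2) (2*5*(1*(4*3)))).
rewrite eq_ab; transitivity (t * s * (t' * (b * v))).
  by rewrite (AC (2*(1*2)) (3*5*(1*(4*2)))).
by rewrite eq_bc (AC (2*(1*2)) (1*3*5*(4*2))).
Qed.

Canonical loceq_equiv := EquivRel loceq loceq_refl loceq_sym loceq_trans.

Definition localization := {eq_quot loceq}%qT.

HB.instance Definition _ := EqQuotient.on localization.
HB.instance Definition _ := Choice.on localization.

Lemma loceqE x y : (x == y %[mod localization])%qT = loceq x y.
Proof. by rewrite eqmodE. Qed.

Lemma loceq_cross x y : x.1 * y.2 = y.1 * x.2 -> loceq x y.
Proof. by move=> eq_xy; apply/asboolP; exists 1; rewrite ?rpred1 ?eq_xy. Qed.

Definition frac_of (r : R) : locfrac := LocFrac (locpair := (r, 1)) (rpred1 S).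

Definition loc_in : R -> localization := lift_embed localization frac_of.
Canonical loc_in_pi_morph := PiEmbed loc_in.

Lemma loc_inE (r : R) : loc_in r = \pi_localization (frac_of r).
Proof. by unlock loc_in. Qed.

Definition addfrac x y : locfrac :=
  LocFrac (locpair := (x.1 * y.2 + y.1 * x.2, x.2 * y.2))
    (rpredM (locfracP x) (locfracP y)).
Definition locadd := lift_op2 localization addfrac.

Definition oppfrac x : locfrac :=
  LocFrac (locpair := (- x.1, x.2)) (locfracP x).
Definition locopp := lift_op1 localization oppfrac.

Definition mulfrac x y : locfrac :=
  LocFrac (locpair := (x.1 * y.1, x.2 * y.2))
    (rpredM (locfracP x) (locfracP y)).
Definition locmul := lift_op2 localization mulfrac.

Lemma loceq_add x x' y y' :
  loceq x x' -> loceq y y' -> loceq (addfrac x y) (addfrac x' y').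
Proof.
move=> /asboolP[t St eq_x] /asboolP[u Su eq_y].
apply/asboolP; exists (t * u); rewrite ?rpredM //=.
transitivity (t * (x.1 * x'.2) * (u * y.2 * y'.2)
              + u * (y.1 * y'.2) * (t * x.2 * x'.2)).
  by ring.
by rewrite eq_x eq_y; ring.
Qed.

Lemma loceq_opp x x' : loceq x x' -> loceq (oppfrac x) (oppfrac x').
Proof.
by case/asboolP=> t St eq_x; apply/asboolP; exists t; rewrite //= !mulNr !mulrN eq_x.
Qed.

Lemma loceq_mul x x' y y' :
  loceq x x' -> loceq y y' -> loceq (mulfrac x y) (mulfrac x' y').
Proof.
move=> /asboolP[t St eq_x] /asboolP[u Su eq_y].
apply/asboolP; exists (t * u); rewrite ?rpredM //=.
transitivity (t * (x.1 * x'.2) * (u * (y.1 * y'.2))); first by ring.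
by rewrite eq_x eq_y; ring.
Qed.

Let loceq_repr x : loceq (repr (\pi_localization x)) x.
Proof. by rewrite -loceqE reprK. Qed.

Lemma pi_locadd : {morph \pi : x y / addfrac x y >-> locadd x y}.
Proof.
move=> x y; unlock locadd; apply/eqP; rewrite loceqE loceq_sym.
by apply: loceq_add; apply: loceq_repr.
Qed.
Canonical pi_locadd_morph := PiMorph2 pi_locadd.

Lemma pi_locopp : {morph \pi : x / oppfrac x >-> locopp x}.
Proof.
move=> x; unlock locopp; apply/eqP; rewrite loceqE loceq_sym.
by apply: loceq_opp; apply: loceq_repr.
Qed.
Canonical pi_locopp_morph := PiMorph1 pi_locopp.

Lemma pi_locmul : {morph \pi : x y / mulfrac x y >-> locmul x y}.
Proof.
move=> x y; unlock locmul; apply/eqP; rewrite loceqE loceq_sym.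
by apply: loceq_mul; apply: loceq_repr.
Qed.
Canonical pi_locmul_morph := PiMorph2 pi_locmul.

Lemma locaddA : associative locadd.
Proof.
elim/quotW=> x; elim/quotW=> y; elim/quotW=> z; apply/eqP.
by rewrite !piE; apply: loceq_cross => /=; ring.
Qed.

Lemma locaddC : commutative locadd.
Proof.
elim/quotW=> x; elim/quotW=> y; apply/eqP.
by rewrite !piE; apply: loceq_cross => /=; ring.
Qed.

Lemma locadd0 : left_id (loc_in 0) locadd.
Proof.
by elim/quotW=> x; apply/eqP; rewrite !piE; apply: loceq_cross => /=; ring.
Qed.

Lemma locaddN : left_inverse (loc_in 0) locopp locadd.
Proof.
by elim/quotW=> x; apply/eqP; rewrite !piE; apply: loceq_cross => /=; ring.
Qed.

HB.instance Definition _ :=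
  GRing.isZmodule.Build localization locaddA locaddC locadd0 locaddN.

Lemma locmulA : associative locmul.
Proof.
elim/quotW=> x; elim/quotW=> y; elim/quotW=> z; apply/eqP.
by rewrite !piE; apply: loceq_cross => /=; ring.
Qed.

Lemma locmulC : commutative locmul.
Proof.
elim/quotW=> x; elim/quotW=> y; apply/eqP.
by rewrite !piE; apply: loceq_cross => /=; ring.
Qed.

Lemma locmul1 : left_id (loc_in 1) locmul.
Proof.
by elim/quotW=> x; apply/eqP; rewrite !piE; apply: loceq_cross => /=; ring.
Qed.

Lemma locmulD : left_distributive locmul locadd.
Proof.
elim/quotW=> x; elim/quotW=> y; elim/quotW=> z; apply/eqP.
by rewrite !piE; apply: loceq_cross => /=; ring.
Qed.

HB.instance Definition _ := GRing.Zmodule_isComPzRing.Build localization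
  locmulA locmulC locmul1 locmulD.

Lemma loc_in_is_zmod_morphism : zmod_morphism loc_in.
Proof.
move=> r s; apply/eqP; rewrite !loc_inE -[X in _ == _ + X]pi_locopp -[X in _ == X]pi_locadd loceqE.
by apply: loceq_cross => /=; ring.
Qed.

Lemma loc_in_is_monoid_morphism : monoid_morphism loc_in.
Proof.
split=> // r s; apply/eqP; rewrite !loc_inE -[X in _ == X]pi_locmul loceqE.
by apply: loceq_cross => /=; ring.
Qed.

HB.instance Definition _ :=
  GRing.isZmodMorphism.Build R localization loc_in loc_in_is_zmod_morphism.
HB.instance Definition _ :=
  GRing.isMonoidMorphism.Build R localization loc_in loc_in_is_monoid_morphism.

Lemma loc_in_eq r s :
  loc_in r = loc_in s <-> exists2 t, t \in S & t * r = t * s.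
Proof.
split=> [/eqP|[t St eq_t]]; last first.
  by apply/eqP; rewrite !piE; apply/asboolP; exists t; rewrite //= !mulr1.
by rewrite !piE => /asboolP[t St] /=; rewrite !mulr1; exists t.
Qed.

Lemma loc_in_inv s : s \in S -> exists v, loc_in s * v = 1.
Proof.
move=> Ss; exists (\pi_localization (LocFrac (locpair := (1, s)) Ss)); apply/eqP.
have -> : 1 = \pi_localization (frac_of 1) by rewrite -loc_inE.
rewrite !loc_inE -[X in X == _]pi_locmul loceqE.
by apply: loceq_cross => /=; ring.
Qed.

Lemma loc_fracP (a : localization) :
  exists r s, s \in S /\ a * loc_in s = loc_in r.
Proof.
elim/quotW: a => x; exists x.1, x.2; split; first exact: locfracP.
apply/eqP; rewrite !loc_inE -[X in X == _]pi_locmul loceqE.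
by apply: loceq_cross => /=; ring.
Qed.
End Localization.

Section LocalizationModule.
Variables (K : comNzRingType) (A : comAlgType K) (S : mulrClosed A).

(* The base ring acts through its image c |-> c * 1 in A. *)
Definition locscale (c : K) (a : localization S) := loc_in S c%:A * a.

Lemma locscaleA c d a : locscale c (locscale d a) = locscale (c * d) a.
Proof. by rewrite /locscale mulrA -rmorphM -scalerAl mul1r scalerA. Qed.

Lemma locscale1 : left_id 1 locscale.
Proof. by move=> a; rewrite /locscale scale1r rmorph1 mul1r. Qed.

Lemma locscaleDr : right_distributive locscale +%R.
Proof. by move=> c a b; rewrite /locscale mulrDr. Qed.

Lemma locscaleDl a : {morph locscale^~ a : c d / c + d}.
Proof. by move=> c d; rewrite /locscale scalerDl rmorphD mulrDl. Qed.

HB.instance Definition _ := GRing.Zmodule_isLmodule.Build K (localization S)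
  locscaleA locscale1 locscaleDr locscaleDl.
End LocalizationModule.

Section LaurentSeries.
Variables (n : nat) (R : comNzRingType).

(* k[[x_1, ..., x_n]][x_1^-1, ..., x_n^-1] *)
Definition lseries := localization (R := mpseries n R) (@psmonomial n R).

HB.instance Definition _ := GRing.ComPzRing.on lseries.
HB.instance Definition _ := GRing.Lmodule.on lseries.

Lemma lseries1_neq0 : 1 != 0 :> lseries.
Proof.
apply/eqP => /(@loc_in_eq (mpseries n R) _ 1 0)[t St]; rewrite mulr1 mulr0 => /eqP.
by rewrite (negPf (psmonomial_neq0 St)).
Qed.

HB.instance Definition _ :=
  GRing.PzSemiRing_isNonZero.Build lseries lseries1_neq0.

Lemma lseries_scaleAl (c : R) (a b : lseries) : c *: (a * b) = (c *: a) * b.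
Proof. exact: mulrA. Qed.

HB.instance Definition _ :=
  GRing.Lmodule_isLalgebra.Build R lseries lseries_scaleAl.
HB.instance Definition _ := GRing.Lalgebra_isComAlgebra.Build R lseries.
End LaurentSeries.

Section Derivations.
Variable k : fieldType.

Definition is_derivation (A : comAlgType k) (D : {linear A -> A}) : Prop :=
  forall a b : A, D (a * b) = D a * b + a * D b.

Definition in_span (V : lmodType k) (P : V -> Prop) (v : V) : Prop :=
  exists (r : nat) (c : 'I_r -> k) (u : 'I_r -> V),
    (forall i, P (u i)) /\ v = \sum_(i < r) c i *: u i.

(* Intended for subspaces P: some finite family in P spans P. *)
Definition finite_dimensional (V : lmodType k) (P : V -> Prop) : Prop :=
  exists s : seq V, forall v, P v <-> in_span (fun u => u \in s) v.

Definition locally_finite (A : comAlgType k) (D : {linear A -> A}) : Prop :=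
  forall a : A,
    finite_dimensional (in_span (fun b => exists m : nat, b = iter m D a)).

End Derivations.

(* Main.v *)
Require Import Defs.
From HB Require Import structures.
From mathcomp Require Import all_boot all_order all_algebra.
From mathcomp Require Import boolp.
From mathcomp Require Import mpoly ring.

Set Implicit Arguments.
Unset Strict Implicit.
Unset Printing Implicit Defensive.

Import Order.TTheory GRing.Theory.
Local Open Scope ring_scope.

(** Let A be the algebra of Laurent series and u a unit of A, with inverse v.
    The heart of the proof is that a locally finite derivation D has an
    algebraic logarithmic derivative w = v * D u at u.  Over an algebraically
    closed field this is the statement that units are homogeneous for the
    grading of A by generalized eigenspaces of D; over k itself, the following
    degree argument takes the place of this grading.

    Let V^s be the span of the s-fold products of the iterated derivatives of
    u; the sum of the V^s is a graded algebra stable under D.  Since u^(j+1)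
    D^j v lies in V^j ([form_inv_der]) and the D^j v span a finite-dimensional
    space, some power of u lies in the homogeneous ideal J, where J_s consists
    of the b in V^(s+1) such that b * D^j v lies in V^s for all j
    ([conductor]).  J is stable under D, and in characteristic zero the radical
    of a differential ideal is differential ([conductor_nilpotent_der]).  Hence
    every D^i u has a power in J, and as finitely many of them span all the
    others, J contains all of V^(s+1) for large s ([form_conductor]).  Then
    V^(s+1) v is contained in V^s for s >= M, so that the powers of w, which
    are w^t = v^(M+t) u^M (D u)^t, all lie in the finite-dimensional space
    v^M V^M: w is algebraic over k ([logder_algebraic]).

    A is a domain of characteristic zero, so D vanishes on algebraic elements
    ([der_algebraic]).  A power series f without constant term gives two units
    1 + f and 2 + f, hence D f = w1 (1 + f) = w2 (2 + f) with D w1 = D w2 = 0.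
    Applying D once more, (w1 - w2) D f = 0, and w1 = w2 forces w1 = 0; either
    way D f = 0 ([der_two_units]).  So D kills k[[x]], hence its localization.
    Infinite sums cannot be differentiated term by term, as D may a priori be
    discontinuous for the x-adic topology; this is why f is compared with units
    that are polynomials in f. *)

(** * Spans of finite families *)

Section FiniteSpan.
Variables (k : fieldType) (V : lmodType k).

Definition fspan (I : finType) (F : I -> V) (v : V) : Prop :=
  exists c : I -> k, v = \sum_i c i *: F i.

Lemma fspan_gen (I : finType) (F : I -> V) i : fspan F (F i).
Proof.
exists (fun j => (j == i)%:R).
rewrite (bigD1 i) //= eqxx scale1r big1 ?addr0 //.
by move=> j /negPf->; rewrite scale0r.
Qed.

Lemma fspan0 (I : finType) (F : I -> V) : fspan F 0.
Proof. by exists (fun=> 0); rewrite big1 // => i _; rewrite scale0r. Qed.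

Lemma fspan_lin (I : finType) (F : I -> V) a v w :
  fspan F v -> fspan F w -> fspan F (a *: v + w).
Proof.
move=> [c ->] [d ->]; exists (fun i => a * c i + d i).
rewrite scaler_sumr -big_split; apply: eq_bigr => i _.
by rewrite scalerDl scalerA.
Qed.

Lemma fspan_sum (I J : finType) (F : I -> V) (G : J -> V) (c : J -> k) :
  (forall j, fspan F (G j)) -> fspan F (\sum_j c j *: G j).
Proof.
move=> FG; elim/big_ind: _ => [|v w Fv Fw|j _]; first exact: fspan0.
  by rewrite -[v]scale1r; apply: fspan_lin.
by rewrite -[X in fspan _ X]addr0; apply: fspan_lin; last exact: fspan0.
Qed.

(** Infinitely many vectors in a finite-dimensional space are dependent, by
    a left kernel vector of the matrix of their first coordinate rows. *)
Lemma fspan_dependence (I : finType) (F : I -> V) (y : nat -> V) :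
    (forall t, fspan F (y t)) ->
  exists N (a : nat -> k),
    (exists2 t, (t < N)%N & a t != 0) /\ \sum_(t < N) a t *: y t = 0.
Proof.
move=> /choice[c yE]; pose r := #|I|.
pose C := \matrix_(t < r.+1, i < r) c t (enum_val i).
have /rowV0Pn[a /sub_kermxP aC0 a0] : kermx C != 0.
  rewrite -mxrank_eq0 mxrank_ker subn_eq0 -ltnNge ltnS; exact: rank_leq_col.
exists r.+1, (fun t => a 0 (inord t)); split.
  have /rV0Pn[t at0] := a0; exists (t : nat); first exact: ltn_ord.
  by rewrite inord_val.
transitivity (\sum_(t < r.+1) \sum_i (a 0 t * c t i) *: F i).
  apply: eq_bigr => t _; rewrite inord_val yE scaler_sumr.
  by apply: eq_bigr => i _; rewrite scalerA.
rewrite exchange_big big1 // => i _.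
rewrite -scaler_suml [X in X *: _](_ : _ = 0) ?scale0r //.
have /rowP/(_ (enum_rank i)) := aC0; rewrite !mxE => aCi.
rewrite -[RHS]aCi; apply: eq_bigr => t _.
by rewrite mxE enum_rankK.
Qed.
End FiniteSpan.

(** * Derivations *)

Section Derivation.
Variables (k : fieldType) (A : comAlgType k) (D : {linear A -> A}).
Hypothesis derD : is_derivation D.
Implicit Types (a b u v w : A).

Lemma der1 : D 1 = 0.
Proof.
have := derD 1 1; rewrite !mulr1 mul1r => /(congr1 (+%R^~ (- D 1))).
by rewrite subrr addrK.
Qed.

Lemma der_scalar c : D c%:A = 0.
Proof. by rewrite linearZ /= der1 scaler0. Qed.

Lemma derX a m : D (a ^+ m.+1) = m.+1%:R * a ^+ m * D a.
Proof.
elim: m => [|m IHm]; first by rewrite expr1 expr0 !mul1r.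
rewrite exprS derD IHm -[m.+2%:R]natr1 exprS mulrDl mul1r mulrDl addrC.
by congr (_ + _); [ring | rewrite mulrC].
Qed.

Lemma der_horner_alg w (q : {poly k}) :
  D (horner_alg w q) = horner_alg w q^`() * D w.
Proof.
elim/poly_ind: q => [|q c IHq]; first by rewrite deriv0 !rmorph0 mul0r linear0.
rewrite derivD derivC addr0 derivM derivX mulr1 !rmorphD !rmorphM /=.
rewrite !horner_algX horner_algC linearD /= der_scalar addr0 derD IHq.
by rewrite mulrAC mulrDl.
Qed.

(** A spanning family of the orbit of [a] only involves finitely many iterates
    of [D], so an initial segment of the orbit already spans it. *)
Lemma locally_finite_fspan a : locally_finite D ->
  exists d, forall m, fspan (fun i : 'I_d => iter i D a) (iter m D a).
Proof.
move=> /(_ a)[s sP].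
pose F d (i : 'I_d) := iter i D a.
have F_le d e x : (d <= e)%N -> fspan (@F d) x -> fspan (@F e) x.
  move=> le_de [c ->]; apply: fspan_sum => i.
  exact: (fspan_gen (@F e) (widen_ord le_de i)).
have [d dP] : exists d, forall x, x \in s -> fspan (@F d) x.
  have {sP}: forall x, x \in s -> exists d, fspan (@F d) x.
    move=> x xs; have /sP : in_span (fun y => y \in s) x.
      exists 1%N, (fun=> 1), (fun=> x); split=> //.
      by rewrite big_ord1 scale1r.
    case=> r [c [y [/choice[h yE] ->]]]; exists (\max_i h i).+1.
    apply: fspan_sum => i; rewrite yE.
    have lt_i : (h i < (\max_i h i).+1)%N := leq_bigmax i.
    exact: (fspan_gen (@F _) (Ordinal lt_i)).
  elim: s => [|x s IHs] sP; first by exists 0%N.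
  have [|d dP] := IHs; first by move=> y ys; apply: sP; rewrite inE ys orbT.
  have [|e eP] := sP x; first by rewrite inE eqxx.
  exists (maxn d e) => y; rewrite inE => /predU1P[->|ys].
    exact: F_le (leq_maxr _ _) eP.
  exact: F_le (leq_maxl _ _) (dP _ ys).
exists d => m; have /sP[r [c [y [ys ->]]]] :
    in_span (fun b => exists m, b = iter m D a) (iter m D a).
  exists 1%N, (fun=> 1), (fun=> iter m D a); split; first by exists m.
  by rewrite big_ord1 scale1r.
by apply: fspan_sum => i; apply: dP.
Qed.
End Derivation.

(** * Homogeneous forms in a sequence of elements *)

Section Forms.
Variables (k : fieldType) (A : comAlgType k) (g : nat -> A).

(** The values of the homogeneous polynomials of degree [s] in the [g i].  The
    degree is an index and not a function of the element: one element may be a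
    form of several degrees, and the proof lives on lowering this degree. *)
Inductive form : nat -> A -> Prop :=
| form_one : form 0 1
| form_lin s c a b : form s a -> form s b -> form s (c *: a + b)
| form_gen s i a : form s a -> form s.+1 (g i * a).

Lemma formZ s c a : form s a -> form s (c *: a).
Proof.
move=> Fa.
have -> : c *: a = (c - 1) *: a + a by rewrite scalerBl scale1r subrK.
exact: form_lin.
Qed.

Lemma formD s a b : form s a -> form s b -> form s (a + b).
Proof. by move=> Fa Fb; rewrite -[a]scale1r; apply: form_lin. Qed.

Lemma formB s a b : form s a -> form s b -> form s (a - b).
Proof. by move=> Fa Fb; rewrite addrC -scaleN1r; apply: form_lin. Qed.

Lemma formMn s m a : form s a -> form s (m%:R * a).
Proof. by rewrite mulr_natl -scaler_nat; apply: formZ. Qed.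

Lemma formM s t a b : form s a -> form t b -> form (s + t) (a * b).
Proof.
move=> Fa Fb; elim: Fa => [|s' c x y _ IHx _ IHy|s' i x _ IHx].
- by rewrite mul1r.
- by rewrite mulrDl -scalerAl; apply: form_lin.
- by rewrite -mulrA addSn; apply: form_gen.
Qed.

Lemma form1 i : form 1 (g i).
Proof. by rewrite -[g i]mulr1; apply/form_gen/form_one. Qed.

Lemma formX m a : form 1 a -> form m (a ^+ m).
Proof.
move=> Fa; elim: m => [|m IHm]; first exact: form_one.
by rewrite exprS; apply: (formM Fa).
Qed.

Lemma form0 s : form s 0.
Proof.
by rewrite -(subrr (g 0 ^+ s)); apply: formB; apply/formX/form1.
Qed.

Lemma form_prod (I : Type) (w : seq I) (P : pred I) (f : I -> nat) :
  form (count P w) (\prod_(i <- w | P i) g (f i)).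
Proof.
elim: w => [|i w IHw]; first by rewrite big_nil; apply: form_one.
by rewrite big_cons /=; case: (P i) => //; apply: form_gen.
Qed.

(** If the first [d] elements of [g] span the others, forms of degree [s] are
    spanned by the finitely many words of length [s] in these [d] letters. *)
Lemma form_words d s a :
    (forall i, fspan (fun j : 'I_d => g j) (g i)) -> form s a ->
  fspan (fun w : s.-tuple 'I_d => \prod_(i <- w) g i) a.
Proof.
move=> gP; elim=> [|{}s c x y _ IHx _ IHy|{}s i x _ [c ->]].
- have := fspan_gen (fun w : 0.-tuple 'I_d => \prod_(i <- w) g i) [tuple].
  by rewrite big_nil.
- exact: fspan_lin.
have [e ->] := gP i; rewrite mulr_suml.
under eq_bigr => j _ do rewrite -scalerAl.
apply: fspan_sum => j; rewrite mulr_sumr.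
under eq_bigr => w _ do rewrite -scalerAr.
apply: fspan_sum => w.
have := fspan_gen (fun w : s.+1.-tuple 'I_d => \prod_(i <- w) g i)
  [tuple of j :: w].
by rewrite big_cons.
Qed.

End Forms.

(** * The logarithmic derivative of a unit *)

Section UnitDerivative.
Variables (k : fieldType) (A : comAlgType k) (D : {linear A -> A}).
Hypothesis chark0 : [pchar k] =i pred0.
Hypothesis derD : is_derivation D.
Hypothesis lfD : locally_finite D.
Variables (u v : A).
Hypothesis uv1 : u * v = 1.

Local Notation F := (form (fun i => iter i D u)).

Lemma form_der s a : F s a -> F s (D a).
Proof.
elim=> [|{}s c x y Fx IHx Fy IHy|{}s i x Fx IHx].
- rewrite (der1 derD) -(subrr 1); apply: formB; exact: form_one.
- by rewrite linearP; apply: form_lin.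
rewrite derD; apply: formD; first by apply: (form_gen (g := fun i => _) i.+1).
exact: form_gen.
Qed.

Lemma form_unit : F 1 u. Proof. exact: (form1 _ 0). Qed.

(** The quotient rule without denominators: each derivative of [v = u^-1]
    costs one more factor [u], and the numerator gains one degree. *)
Lemma form_inv_der j : F j (u ^+ j.+1 * iter j D v).
Proof.
elim: j => [|j IHj]; first by rewrite expr1 uv1; apply: form_one.
have -> : u ^+ j.+2 * iter j.+1 D v =
    u * D (u ^+ j.+1 * iter j D v) - j.+1%:R * (D u * (u ^+ j.+1 * iter j D v)).
  rewrite derD (derX derD) /= exprS; set x := iter j D v; set y := D x.
  rewrite mulrDr [u ^+ j.+1]exprS; ring.
apply: formB; first exact: (formM form_unit (form_der IHj)).
by apply: formMn; apply: (formM (form_der form_unit)).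
Qed.

(** The degree [s + 1] part of the conductor of the derivatives of [v] into the
    forms: multiplication by a derivative of [v] must lower the degree by one,
    as multiplication by [v] itself does on multiples of [u]. *)
Definition conductor s b := F s.+1 b /\ forall j, F s (b * iter j D v).

Lemma conductor_lin s c a b :
  conductor s a -> conductor s b -> conductor s (c *: a + b).
Proof.
move=> [Fa Ca] [Fb Cb]; split=> [|j]; first exact: form_lin.
by rewrite mulrDl -scalerAl; apply: form_lin.
Qed.

Lemma conductor0 s : conductor s 0.
Proof. by split=> [|j]; rewrite ?mul0r; apply: form0. Qed.

Lemma conductorM s t a b : conductor s a -> F t b -> conductor (s + t) (a * b).
Proof.
move=> [Fa Ca] Fb; split=> [|j]; first by rewrite -addSn; apply: formM.
by rewrite mulrAC; apply: formM.
Qed.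

Lemma conductor_der s a : conductor s a -> conductor s (D a).
Proof.
move=> [Fa Ca]; split=> [|j]; first exact: form_der.
have -> : D a * iter j D v = D (a * iter j D v) - a * iter j.+1 D v.
  by rewrite derD addrK.
by apply: formB => //; apply: form_der.
Qed.

Lemma conductorZ s c a : conductor s a -> conductor s (c *: a).
Proof.
move=> Ca.
have -> : c *: a = (c - 1) *: a + a by rewrite scalerBl scale1r subrK.
exact: conductor_lin.
Qed.

Lemma conductorB s a b : conductor s a -> conductor s b -> conductor s (a - b).
Proof. by move=> Ca Cb; rewrite addrC -scaleN1r; apply: conductor_lin. Qed.

Lemma conductorVn s m a : conductor s (m.+1%:R * a) -> conductor s a.
Proof.
rewrite mulr_natl -scaler_nat => /(conductorZ (m.+1%:R)^-1).
by rewrite scalerA mulVf ?scale1r // (pcharf0P k).1.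
Qed.

(** [form_inv_der] puts u^(d+1) D^j v in degree [d] for j < d, and local
    finiteness of [D] at [v] reduces all [j] to these. *)
Lemma conductor_unit : exists s, conductor s (u ^+ s.+1).
Proof.
have [d vP] := locally_finite_fspan v lfD.
exists d; split=> [|m]; first by apply: formX form_unit.
have [c ->] := vP m; rewrite mulr_sumr.
elim/big_rec: _ => [|j x _ Fx]; first exact: form0.
rewrite -scalerAr; apply: form_lin => //.
have lt_jd := ltn_ord j.
have -> : u ^+ d.+1 = u ^+ (d - j) * u ^+ j.+1.
  by rewrite -exprD addnS subnK // ltnW.
rewrite -mulrA -{1}(subnK (ltnW lt_jd)).
by apply: formM; [apply: formX form_unit | apply: form_inv_der].
Qed.

(** The radical of a differential ideal is differential in characteristic
    zero.  By induction on [q], differentiating a^(l+1) (D a)^(2q+1) in the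
    ideal and multiplying by [D a] trades one factor [a] for two factors [D a],
    up to a multiple of the element one started from. *)
Lemma conductor_nilpotent_der s a :
  F 1 a -> conductor s (a ^+ s.+1) -> exists t, conductor t (D a ^+ t.+1).
Proof.
move=> Fa Ca; exists (s + s)%N.
suff /(_ s 0%N): forall q l, (l + q)%N = s ->
    conductor (s + q) (a ^+ l * D a ^+ (q + q).+1).
  by rewrite expr0 mul1r; apply.
have FDa := form_der Fa.
elim=> [|q IHq] l lq.
  rewrite !addn0 in lq *; rewrite lq expr1.
  apply: (@conductorVn _ s); rewrite mulrA -(derX derD).
  exact: conductor_der.
have {IHq}C : conductor (s + q) (a ^+ l.+1 * D a ^+ (q + q).+1).
  by apply: IHq; rewrite addSnnS.
apply: (@conductorVn _ l).
have -> : l.+1%:R * (a ^+ l * D a ^+ (q.+1 + q.+1).+1) =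
    D (a ^+ l.+1 * D a ^+ (q + q).+1) * D a
    - (q + q).+1%:R *: (a ^+ l.+1 * D a ^+ (q + q).+1 * D (D a)).
  rewrite derD !(derX derD) addSn addnS scaler_nat -mulr_natl.
  set m := (q + q)%N; set x := D a; set y := D x.
  rewrite !exprS; ring.
rewrite addnS -addn1; apply: conductorB.
  by apply: conductorM => //; apply: conductor_der.
by apply: conductorZ; apply: conductorM => //; apply: form_der.
Qed.

Lemma conductor_pow_iter i : exists s, conductor s (iter i D u ^+ s.+1).
Proof.
elim: i => [|i [s Cs]]; first exact: conductor_unit.
exact: (conductor_nilpotent_der (form1 _ i) Cs).
Qed.

(** A word of length s + 1 > h_1 + ... + h_d contains some letter j more than
    h_j times; that power of the letter puts the word in the conductor. *)
Lemma form_conductor :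
  exists M, forall s a, (M <= s)%N -> F s.+1 a -> conductor s a.
Proof.
have [d uP] := locally_finite_fspan u lfD.
have /choice[h hP] := conductor_pow_iter.
exists (\sum_(j < d) h j)%N => s a le_s /(form_words uP)[c ->].
suff Cw (w : seq 'I_d) :
    size w = s.+1 -> conductor s (\prod_(i <- w) iter i D u).
  elim/big_rec: _ => [|w x _ Cx]; first exact: conductor0.
  by apply: conductor_lin Cx; apply: Cw; rewrite size_tuple.
move=> size_w; have [j lt_hj] : exists j : 'I_d, (h j < count_mem j w)%N.
  apply: contrapT => /forallNP noj.
  have : (\sum_(j < d) count_mem j w <= \sum_(j < d) h j)%N.
    by apply: leq_sum => j _; rewrite leqNgt; apply/negP/noj.
  rewrite leqNgt => /negP; apply; rewrite (leq_ltn_trans le_s) //.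
  suff -> : (\sum_(j < d) count_mem j w)%N = size w by rewrite size_w.
  rewrite -sum1_size [RHS](partition_big id xpredT) //.
  by apply: eq_bigr => j _; rewrite sum1_count.
have -> : s = (h j + (count_mem j w - (h j).+1 + count (predC (pred1 j)) w))%N.
  apply: succn_inj; rewrite -addSn addnA subnKC //.
  by rewrite count_predC.
rewrite (bigID (pred1 j)) /=.
have -> : \prod_(i <- w | i == j) iter i D u = iter j D u ^+ count_mem j w.
  rewrite (eq_bigr (fun=> iter j D u)) => [|i /eqP-> //].
  by rewrite big_const_seq iter_mulr_1.
rewrite -[X in _ ^+ X](subnKC lt_hj) exprD -mulrA.
apply: conductorM => //; apply: formM; last exact: form_prod.
exact/formX/form1.
Qed.

(** For s >= M a form of degree s + 1 times [v] is a form of degree [s].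
    Applied [t] times to u^M (D u)^t, this brings the [t]-th power of [v * D u]
    into the span of the v^M times words of the fixed length [M]. *)
Lemma logder_algebraic :
  exists2 q : {poly k}, q != 0 & horner_alg (v * D u) q = 0.
Proof.
have [M condM] := form_conductor.
have descend t b : F (M + t) b ->
    exists2 c, F M c & b * v ^+ (M + t) = c * v ^+ M.
  elim: t b => [|t IHt] b; first by rewrite addn0; exists b.
  rewrite addnS => /(condM _ _ (leq_addr t M))[_ /(_ 0%N) /= /IHt[c Fc bvE]].
  by exists c; rewrite // exprS mulrA.
have [d uP] := locally_finite_fspan u lfD.
pose W (w : M.-tuple 'I_d) := (\prod_(i <- w) iter i D u) * v ^+ M.
have pow_span t : fspan W ((v * D u) ^+ t).
  have [|c /(form_words uP)[a ->] powE] := descend t (u ^+ M * D u ^+ t).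
    apply: formM; apply: formX; [exact: form_unit | exact/form_der/form_unit].
  have -> : (v * D u) ^+ t = u ^+ M * D u ^+ t * v ^+ (M + t).
    rewrite exprD mulrACA -exprMn uv1 expr1n mul1r mulrC -exprMn.
    by rewrite [D u * v]mulrC.
  exists a; rewrite powE mulr_suml; apply: eq_bigr => w _.
  by rewrite scalerAl.
have [N [a [[t lt_tN at0] sum0]]] := fspan_dependence pow_span.
exists (\poly_(i < N) a i).
  apply: contraNneq at0 => q0; apply/eqP.
  by have := coef0 k t; rewrite -q0 coef_poly lt_tN.
rewrite poly_def rmorph_sum /= -[RHS]sum0; apply: eq_bigr => i _.
by rewrite linearZ /= rmorphXn /= horner_algX mulr_algl.
Qed.
End UnitDerivative.

(** * Derivations of domains of characteristic zero *)

Section Domain.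
Variables (k : fieldType) (A : comAlgType k) (D : {linear A -> A}).
Hypothesis chark0 : [pchar k] =i pred0.
Hypothesis domA : forall a b : A, a * b = 0 -> a = 0 \/ b = 0.
Hypothesis derD : is_derivation D.

(** If q is a nonzero polynomial of least degree with q(w) = 0, then
    0 = D (q(w)) = q'(w) D w, and q'(w) != 0 by minimality. *)
Lemma der_algebraic (w : A) (q : {poly k}) :
  q != 0 -> horner_alg w q = 0 -> D w = 0.
Proof.
have [n] := ubnP (size q); elim: n q => // n IHn q.
rewrite ltnS => le_qn q0 qw0.
have [le_q1|lt1q] := leqP (size q) 1.
  case/negP: q0; have qE := size1_polyC le_q1.
  move: qw0; rewrite qE horner_algC => /eqP.
  by rewrite scaler_eq0 oner_eq0 orbF polyC_eq0.
have q'0 : q^`() != 0.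
  apply/eqP => /(congr1 (fun p : {poly k} => p`_(size q).-2)).
  rewrite coef_deriv coef0 prednK ?(ltn_predRL 0 (size q)) // => /eqP.
  rewrite -mulr_natr mulf_eq0 -lead_coefE lead_coef_eq0 (negPf q0) /=.
  by rewrite (pcharf0P k).1 // -subn1 subn_eq0 leqNgt lt1q.
have := der_horner_alg derD w q; rewrite qw0 linear0 => /esym/domA[]// q'w0.
apply: IHn q'0 q'w0; apply: leq_trans le_qn; exact: lt_size_deriv.
Qed.

(** The logarithmic derivatives w1, w2 of 1 + f and 2 + f are constants of D
    with D f = w1 (1 + f) = w2 (2 + f), which leaves no room for D f != 0. *)
Lemma der_two_units (f : A) :
    locally_finite D -> (exists v, (1 + f) * v = 1) ->
  (exists v, (1 + 1 + f) * v = 1) -> D f = 0.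
Proof.
move=> lfD [v1 uv1] [v2 uv2].
have D1 := der1 derD.
have D1f : D (1 + f) = D f by rewrite linearD /= D1 add0r.
have D2f : D (1 + 1 + f) = D f by rewrite !linearD /= D1 !add0r.
pose w1 := v1 * D f; pose w2 := v2 * D f.
have Dw1 : D w1 = 0.
  have [q q0] := logder_algebraic chark0 derD lfD uv1.
  by rewrite D1f; apply: der_algebraic.
have Dw2 : D w2 = 0.
  have [q q0] := logder_algebraic chark0 derD lfD uv2.
  by rewrite D2f; apply: der_algebraic.
have f1 : D f = w1 * (1 + f) by rewrite /w1 mulrAC [v1 * _]mulrC uv1 mul1r.
have f2 : D f = w2 * (1 + 1 + f) by rewrite /w2 mulrAC [v2 * _]mulrC uv2 mul1r.
have DDf1 : D (D f) = w1 * D f by rewrite {1}f1 derD Dw1 mul0r add0r D1f.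
have DDf2 : D (D f) = w2 * D f by rewrite {1}f2 derD Dw2 mul0r add0r D2f.
have : (w1 - w2) * D f = 0 by rewrite mulrBl -DDf1 -DDf2 subrr.
case/domA => // /eqP; rewrite subr_eq0 => /eqP w12.
have eqf : w1 * (1 + 1 + f) = w1 * (1 + f) by rewrite -f1 w12 -f2.
have w1_0 : w1 = 0.
  move: eqf; rewrite -addrA mulrDr mulr1 => /(canRL (addrK _))->.
  by rewrite subrr.
by rewrite f1 w1_0 mul0r.
Qed.
End Domain.

(** * Formal power series and Laurent series *)

Section SeriesDomain.
Variables (n : nat) (R : idomainType).
Implicit Types f g : mpseries n R.

Lemma ps_least_monomial f : f != 0 ->
  exists2 m, pscoef f m != 0 & forall m', (m' < m)%O -> pscoef f m' = 0.
Proof.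
move=> f0; have [m fm] : exists m, pscoef f m != 0.
  apply: contrapT => /forallNP f_0; case/eqP: f0; apply/psP => m /=.
  by rewrite if_same; apply/eqP/negPn/negP/f_0.
elim/(@ltmwf n): m fm => m IHm fm.
have [[m' lt_m'm fm']|no_m'] :=
  pselect (exists2 m', (m' < m)%O & pscoef f m' != 0).
  exact: IHm fm'.
exists m => // m' lt_m'm; apply/eqP; apply: contraPT no_m' => fm'.
by apply; exists m'.
Qed.

(** The product of the least monomials of [f] and [g] for a monomial
    well-order arises in [f * g] from a single pair of monomials. *)
Lemma ps_domain f g : f * g = 0 -> f = 0 \/ g = 0.
Proof.
move=> fg0.
have [->|/ps_least_monomial[m fm min_m]] := eqVneq f 0; first by left.
have [->|/ps_least_monomial[l gl min_l]] := eqVneq g 0; first by right.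
have lt_m : (mdeg m < (mdeg (m + l)%MM).+1)%N by rewrite mdegD ltnS leq_addr.
have lt_l : (mdeg l < (mdeg (m + l)%MM).+1)%N by rewrite mdegD ltnS leq_addl.
have /psP/(_ (m + l)%MM) := fg0; rewrite /= if_same.
rewrite (bigD1 (BMultinom lt_m, BMultinom lt_l)) //= big1; last first.
  move=> [p q] /= /andP[/eqP eq_pq ne_pq].
  have [lt_pm|le_mp] := ltP (p : 'X_{1..n}) m; first by rewrite min_m ?mul0r.
  have [lt_ql|le_lq] := ltP (q : 'X_{1..n}) l; first by rewrite min_l ?mulr0.
  case/negP: ne_pq; rewrite xpair_eqE; apply/andP.
  move: le_mp le_lq; rewrite !le_eqVlt => /orP[/eqP eq_m|lt_mp] le_lq.
    split; apply/eqP/val_inj; rewrite /= ?eq_m //.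
    (* the types of p and q depend on m and l, so rewriting is not possible *)
    apply: (@addmI _ m).
    exact: etrans (congr1 (fun x => x + _)%MM eq_m) (esym eq_pq).
  have : ((m + l)%MM < (p + q)%MM)%O by apply: ltmc_le_add; rewrite ?le_eqVlt.
  by move/lt_eqF/eqP; case.
by rewrite addr0 => /eqP; rewrite mulf_eq0 (negPf fm) (negPf gl).
Qed.
End SeriesDomain.

Section SeriesUnits.
Variables (n : nat).

Lemma pscoefMr_eq (R : comNzRingType) (f g g' : mpseries n R) m :
    (forall m', (mdeg m' <= mdeg m)%N -> pscoef g m' = pscoef g' m') ->
  pscoef (f * g) m = pscoef (f * g') m.
Proof.
move=> eq_g; apply: eq_bigr => -[p q] /= /eqP m_pq; congr (_ * _).
by apply: eq_g; rewrite [X in (_ <= X)%N](congr1 mdeg m_pq) mdegD leq_addl.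
Qed.

Lemma pscoefX_order (R : comNzRingType) (h : mpseries n R) j m :
  pscoef h 0%MM = 0 -> (mdeg m < j)%N -> pscoef (h ^+ j) m = 0.
Proof.
move=> h0; elim: j m => // j IHj m lt_mj; rewrite exprS.
apply: big1 => -[p q] /= /eqP m_pq.
have [p0|p_neq0] := eqVneq (p : 'X_{1..n}) 0%MM; first by rewrite p0 h0 mul0r.
rewrite IHj ?mulr0 //; apply: leq_trans _ (lt_mj : (mdeg m <= j)%N).
rewrite [X in (_ < X)%N](congr1 mdeg m_pq) mdegD.
by rewrite -[X in (X < _)%N]add0n ltn_add2r lt0n mdeg_eq0.
Qed.

(** The inverse of 1 - h is the geometric series: as h^j has order at least j,
    its coefficient at [m] is that of the partial sum up to the degree of
    [m]. *)
Lemma ps_geometric (R : comNzRingType) (h : mpseries n R) :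
  pscoef h 0%MM = 0 -> exists g, (1 - h) * g = 1.
Proof.
move=> h0; pose G d := \sum_(j < d.+1) h ^+ j.
exists (MPSeries (fun m => pscoef (G (mdeg m)) m)); apply/psP => m.
have pscoefD (f g : mpseries n R) l :
  pscoef (f + g) l = pscoef f l + pscoef g l by [].
have agree l :
    (mdeg l <= mdeg m)%N -> pscoef (G (mdeg l)) l = pscoef (G (mdeg m)) l.
  move=> le_lm; rewrite /G -[in RHS](subnKC le_lm) -addSn big_split_ord /=.
  rewrite -[LHS]addr0; congr (_ + _); symmetry.
  elim/big_ind: _ => [|f g fl gl|j _]; first by rewrite /= if_same.
    by rewrite pscoefD fl gl addr0.
  by rewrite pscoefX_order // ltnS leq_addr.
have {agree}-> : pscoef ((1 - h) * MPSeries (fun l => pscoef (G (mdeg l)) l)) m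
    = pscoef ((1 - h) * G (mdeg m)) m by apply: pscoefMr_eq => l /agree.
have -> : (1 - h) * G (mdeg m) = 1 - h ^+ (mdeg m).+1.
  by rewrite -[RHS]opprB subrX1 -mulNr opprB.
have /eqP := pscoefX_order h0 (ltnSn (mdeg m)); rewrite -oppr_eq0 => /eqP hX0.
by rewrite pscoefD -[RHS]addr0 -[in RHS]hX0.
Qed.

Lemma ps_unit (k : fieldType) (f : mpseries n k) :
  pscoef f 0%MM != 0 -> exists g, f * g = 1.
Proof.
set c := pscoef f 0%MM => c0.
have [|g gE] := @ps_geometric k (1 - c^-1 *: f).
  by rewrite /= eqxx -/c mulVf // subrr.
exists (c^-1 *: g); rewrite -scalerAr scalerAl -gE; congr (_ * _).
by rewrite opprB addrC subrK.
Qed.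
End SeriesUnits.

Section LaurentSeries.
Variables (n : nat) (k : fieldType).
Notation iota := (loc_in (@psmonomial n k)).

Lemma loc_in_eq0 (f : mpseries n k) : iota f = 0 -> f = 0.
Proof.
rewrite -(raddf0 iota) => /loc_in_eq[t St]; rewrite mulr0 => /ps_domain[t0|//].
by have := psmonomial_neq0 St; rewrite t0 eqxx.
Qed.

Lemma lseries_domain (a b : lseries n k) : a * b = 0 -> a = 0 \/ b = 0.
Proof.
have num0 (c : lseries n k) s :
    s \in @psmonomial n k -> c * iota s = 0 -> c = 0.
  move=> /loc_in_inv[v sv1] cs0.
  by rewrite -[c]mulr1 -[1]sv1 mulrA cs0 mul0r.
have [r [s [Ss asr]]] := loc_fracP a; have [r' [s' [Ss' bsr]]] := loc_fracP b.
move=> ab0; have /loc_in_eq0/ps_domain[r0|r0] : iota (r * r') = 0.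
- by rewrite rmorphM /= -asr -bsr mulrACA [a * b]ab0 mul0r.
- by left; apply: num0 Ss _; rewrite asr r0 raddf0.
- by right; apply: num0 Ss' _; rewrite bsr r0 raddf0.
Qed.
End LaurentSeries.

Theorem theorem3p1 (k : fieldType) (chark0 : [pchar k] =i pred0) (n : nat)
    (D : {linear lseries n k -> lseries n k}) :
  is_derivation D -> locally_finite D -> forall a : lseries n k, D a = 0.
Proof.
move=> derD lfD.
pose iota : mpseries n k -> lseries n k := loc_in (@psmonomial n k).
have iotaD f g : iota (f + g) = iota f + iota g by apply: raddfD.
have iotaM f g : iota (f * g) = iota f * iota g by apply: rmorphM.
have iota1 : iota 1 = 1 by apply: rmorph1.
have iota_unit f : pscoef f 0%MM != 0 -> exists v, iota f * v = 1.
  by case/ps_unit=> g fg1; exists (iota g); rewrite -iotaM fg1 iota1.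
have iotaC c : iota c%:A = c%:A by rewrite -[LHS]mulr1.
have D_max f : pscoef f 0%MM = 0 -> D (iota f) = 0.
  move=> f0; apply: (der_two_units chark0 (@lseries_domain n k) derD lfD).
    rewrite -iota1 -iotaD; apply: iota_unit.
    by rewrite /= f0 eqxx addr0 oner_eq0.
  rewrite -iota1 -!iotaD; apply: iota_unit.
  by rewrite /= f0 eqxx addr0 -[1 + 1]/(2%:R) (pcharf0P k).1.
have D_series f : D (iota f) = 0.
  have -> : f = (pscoef f 0%MM)%:A + (f - (pscoef f 0%MM)%:A).
    by rewrite addrC subrK.
  rewrite iotaD linearD iotaC (der_scalar derD) add0r; apply: D_max.
  by rewrite /= eqxx mulr1 subrr.
move=> a; have [r [s [Ss asr]]] := loc_fracP a.
have [v sv1] := loc_in_inv Ss.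
have : D (a * iota s) = 0 by rewrite [a * _]asr D_series.
rewrite derD D_series mulr0 addr0 => Das0.
by rewrite -[D a]mulr1 -[1]sv1 mulrA Das0 mul0r.
Qed.
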